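(* Let $A=(a_{ij})_{n\times n}$ be a real matrix of order $n$ and let $E=\{(i_l,j_l)\mid 1\le l\le k\}$ be a non-empty set of $k$ distinct pairs in $[n]\times[n]$ with $i_1\le i_2\le\cdots\le i_k$ and $a_{i_lj_l}\neq 0$ for all $l\in[k]$. Then for any fixed $p\in[k]$, $$\det(E[A])\det(A)=\det(E_p[A])\det(\overline{E_p}[A])-\sum_{1\le l\le k,\ l\ne p}(-1)^{i_l+j_l+i_p+j_p}\,a_{i_pj_p}\,a_{i_lj_l}\,\det(E[A]_{i_lj_p})\,\det(A_{i_pj_l}),$$ where $E_p=E\setminus\{(i_p,j_p)\}$ and $\overline{E_p}=\{(i_p,j_p)\}$.
   Context: $[n]=\{1,\ldots,n\}$. For a set $E\subseteq[n]\times[n]$, $E[A]$ denotes the $n\times n$ matrix obtained from $A$ by replacing the $(s,t)$-entry by $0$ for every $(s,t)\in E$ and leaving all other entries unchanged (so $E[A]=A$ if $E=\emptyset$). For a square matrix $B$, $B_{ij}$ denotes the matrix obtained from $B$ by deleting the $i$-th row and the $j$-th column; $E[A]_{ij}$ means $(E[A])_{ij}$. *)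

(* Defs.v *)
From mathcomp Require Import all_boot all_order all_algebra.
From mathcomp Require Import reals.

Set Implicit Arguments.
Unset Strict Implicit.
Unset Printing Implicit Defensive.

Import GRing.Theory.
Local Open Scope ring_scope.

(* E[A] *)
Definition zero_entries (R : nzRingType) (n : nat) (E : {set 'I_n * 'I_n})
    (A : 'M[R]_n) : 'M[R]_n :=
  \matrix_(s, t) if (s, t) \in E then 0 else A s t.

(* B_{ij} *)
Definition del_mx (R : nzRingType) (n : nat) (i j : 'I_n) (B : 'M[R]_n)
    : 'M[R]_n.-1 :=
  row' i (col' j B).

(* Main.v *)
(* With B = E[A], (r, c) = (i_p, j_p) and a = a_{rc}, both E_p[A] and B, and
   A and \overline{E_p}[A], differ only in the entry (r, c), so
     det E_p[A] = det B + a (adj B)_{cr},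
     det \overline{E_p}[A] = det A - a (adj A)_{cr}.
   As A - B is supported on E, the sum over all l (including p) is a times the
   entry (c, r) of
     adj B (A - B) adj A = det A adj B - det B adj A. *)

Require Import Defs.
From mathcomp Require Import all_boot all_order all_algebra.
From mathcomp Require Import reals.
From mathcomp Require Import ring.

Set Implicit Arguments.
Unset Strict Implicit.
Unset Printing Implicit Defensive.

Import Order.TTheory GRing.Theory Num.Theory.
Local Open Scope ring_scope.

(** Expand both determinants along row [r]: the cofactors of that row do not see it, so they agree
    for [M] and [N]. *)
Lemma det_change_entry (R : comNzRingType) (n : nat) (M N : 'M[R]_n)
    (r c : 'I_n) :
  (forall s t, (s, t) != (r, c) -> M s t = N s t) ->
  \det M = \det N + (M r c - N r c) * cofactor N r c.
Proof.
move=> MN.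
have cofE t : cofactor M r t = cofactor N r t.
  congr (_ * \det _); apply/matrixP=> s u; rewrite !mxE MN //.
  by rewrite xpair_eqE eq_sym (negPf (neq_lift _ _)).
rewrite (expand_det_row M r) (expand_det_row N r).
rewrite (bigD1 c) //= [in RHS](bigD1 c) //= cofE.
rewrite (eq_bigr (fun t => N r t * cofactor N r t)); last first.
  by move=> t tc; rewrite cofE MN // xpair_eqE (negPf tc) andbF.
by ring.
Qed.

Lemma mul_adj_sub_adj (R : comNzRingType) (n : nat) (A B : 'M[R]_n) :
  \adj B *m (A - B) *m \adj A = \det A *: \adj B - \det B *: \adj A.
Proof.
rewrite mulmxBr mulmxBl -mulmxA mul_mx_adj mul_adj_mx.
by rewrite mul_mx_scalar mul_scalar_mx.
Qed.

(** Entry [(c, r)] of [mul_adj_sub_adj], where [A - B] equals [A] on [E] and vanishes elsewhere. *)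
Lemma sum_cofactors_zero_entries (R : comNzRingType) (n : nat)
    (E : {set 'I_n * 'I_n}) (A : 'M[R]_n) (r c : 'I_n) :
  \sum_(e in E) cofactor (zero_entries E A) e.1 c * A e.1 e.2
      * cofactor A r e.2
  = \det A * cofactor (zero_entries E A) r c
    - \det (zero_entries E A) * cofactor A r c.
Proof.
set B := zero_entries E A.
have := congr1 (fun M : 'M_n => M c r) (mul_adj_sub_adj A B).
rewrite /= !mxE => <-.
under [RHS]eq_bigr => t _ do rewrite !mxE mulr_suml.
rewrite exchange_big pair_bigA /= big_mkcond; apply: eq_bigr => -[s t] _ /=.
by rewrite !mxE; case: ifP => _; rewrite ?subr0 // subrr mulr0 mul0r.
Qed.

(* Ordinals are 0-based; shifting all four indices in the sign by 1 changes
   the exponent by 4, hence not the sign. *)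
Theorem theorem4p3 (R : realType) (n k : nat) (A : 'M[R]_n)
    (i j : 'I_k -> 'I_n) (E : {set 'I_n * 'I_n})
    (E_def : E = [set (i l, j l) | l : 'I_k])
    (E_neq0 : E != set0)
    (ij_inj : injective (fun l : 'I_k => (i l, j l)))
    (i_mono : forall l m : 'I_k, (l <= m)%N -> (i l <= i m)%N)
    (A_neq0 : forall l : 'I_k, A (i l) (j l) != 0)
    (p : 'I_k) :
  \det (zero_entries E A) * \det A =
    \det (zero_entries (E :\ (i p, j p)) A)
      * \det (zero_entries [set (i p, j p)] A)
    - \sum_(l < k | l != p)
        (-1) ^+ (i l + j l + i p + j p)%N * A (i p) (j p) * A (i l) (j l)
        * \det (del_mx (i l) (j p) (zero_entries E A))
        * \det (del_mx (i p) (j l) A).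
Proof.
set r := i p; set c := j p; set B := zero_entries E A.
have rcE : (r, c) \in E by rewrite E_def imset_f.
have Brc : B r c = 0 by rewrite mxE rcE.
have detEp : \det (zero_entries (E :\ (r, c)) A)
    = \det B + A r c * cofactor B r c.
  rewrite (@det_change_entry _ _ _ B r c) => [|s t st]; last first.
    by rewrite !mxE in_setD1 st.
  by rewrite Brc subr0 mxE setD11.
have detEbar : \det (zero_entries [set (r, c)] A)
    = \det A - A r c * cofactor A r c.
  rewrite (@det_change_entry _ _ _ A r c) => [|s t st]; last first.
    by rewrite !mxE in_set1 (negPf st).
  by rewrite mxE set11 sub0r mulNr.
have := sum_cofactors_zero_entries E A r c.
(* Distinctness of the pairs turns the sum over [E] into one over [l]. *)
rewrite -/B {1}E_def big_imset /=; last by move=> l m _ _ /ij_inj.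
rewrite (bigD1 p) //= -/r -/c => sumE.
have -> : \sum_(l < k | l != p)
      (-1) ^+ (i l + j l + r + c)%N * A r c * A (i l) (j l)
      * \det (del_mx (i l) c B) * \det (del_mx r (j l) A)
  = A r c * \sum_(l < k | l != p)
      cofactor B (i l) c * A (i l) (j l) * cofactor A r (j l).
  (* The sign is the product of the signs of the two cofactors. *)
  rewrite mulr_sumr; apply: eq_bigr => l _; rewrite /cofactor /del_mx !exprD.
  by ring.
rewrite detEp detEbar.
(* The split-off term [l = p], times [A r c], cancels the product of the two corrections in [detEp]
   and [detEbar]. *)
move/(canRL (addKr _)): sumE => ->.
by ring.
Qed.
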